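(* Let $$\mathcal K_{1234}=\Psi_{q^2}\big(e^{p_2+u_2+p_4-u_4-2p_3}\big)\Psi_q\big(e^{p_1+u_1+p_3-u_3-p_2}\big)\Psi_{q^2}\big(e^{p_2+u_2+p_4-u_4-2p_3}\big)^{-1}\rho_{24}\,e^{\frac1\hbar p_1(u_4-u_2)}.$$ In the $p$-representation, for all $c_i,d_i\in\mathbb Z$, $$K^{c_1,c_2,c_3,c_4}_{d_1,d_2,d_3,d_4}:=\langle c_1,c_2,c_3,c_4|\mathcal K_{1234}|d_1,d_2,d_3,d_4\rangle=q^{(\ast\ast)}(-1)^{c_1+c_2-d_4}\frac{(q^{-4(c_1-d_1)};q^4)_{c_2-d_1-d_4}}{(q^4;q^4)_{c_2-d_1-d_4}(q^2;q^2)_{c_1-d_1}}\,\delta^{c_1+c_3}_{d_1+d_3}\,\delta^{c_2+c_4}_{d_2+d_4},$$ where $(\ast\ast)=(c_1-d_1)(-d_1+d_3-2d_4+1)+2(c_2-d_1-d_4)(d_2+d_4-c_3+1)$.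
   Context: $\hbar$ is a generic complex parameter, $q=e^\hbar$. $[p_i,u_i]=\hbar$ for $i=1,3$, $[p_i,u_i]=2\hbar$ for $i=2,4$, all other commutators among $p_1,\dots,p_4,u_1,\dots,u_4$ vanish; exponentials of linear combinations follow $e^Ae^B=e^{[A,B]/2}e^{A+B}$. $p$-representation: on $V=\bigoplus_{c\in\mathbb Z}\mathbb C|c\rangle$, for the $i$-th tensor factor of $V^{\otimes4}$, $p_i|c_i\rangle=\hbar c_i|c_i\rangle$ for $i=1,3$, $p_i|c_i\rangle=2\hbar c_i|c_i\rangle$ for $i=2,4$ (so $e^{p_i}|c_i\rangle=q^{c_i}|c_i\rangle$, resp. $q^{2c_i}|c_i\rangle$), and $e^{u_i}|c_i\rangle=|c_i+1\rangle$; $e^{\frac1\hbar p_1(u_4-u_2)}$ acts on vectors with first label $c_1$ as $e^{c_1(u_4-u_2)}$. $\rho_{24}$ exchanges the second and fourth components. $|c_1,\dots,c_4\rangle=|c_1\rangle\otimes\cdots\otimes|c_4\rangle$; $\langle c_i|$ is the dual basis. $\Psi_q(U)=\sum_{n\ge0}\frac{(-qU)^n}{(q^2;q^2)_n}$, $\Psi_q(U)^{-1}=\sum_{n\ge0}\frac{q^{n^2}U^n}{(q^2;q^2)_n}$, and $\Psi_{q^2}$ is the same with $q\to q^2$ (matrix elements are computed termwise). $(z;q)_n=(z;q)_\infty/(zq^n;q)_\infty$ for $n\in\mathbb Z$ with $(z;q)_\infty=\prod_{k\ge0}(1-zq^k)$; $1/(q;q)_n=0$ for $n<0$, so that the right-hand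 side is zero if $c_2-d_1-d_4<0$ or $c_1-d_1<0$. $\delta^a_b$ is the Kronecker delta. *)

(* Defs.v *)
From HB Require Import structures.
From mathcomp Require Import all_boot all_order all_fingroup all_algebra.
From mathcomp Require Import finmap.
From mathcomp.multinomials Require Import monalg.
From mathcomp Require Import complex.
From mathcomp Require Import all_classical all_reals all_analysis.
From mathcomp Require Import ring.

Set Implicit Arguments.
Unset Strict Implicit.
Unset Printing Implicit Defensive.

Import Order.TTheory GRing.Theory Num.Theory.
Import numFieldNormedType.Exports.

Local Open Scope ring_scope.
Local Open Scope complex_scope.

Section QPochhammer.
Variable F : fieldType.
Implicit Types (z q : F) (n : int).

(* (z;q)_n = (z;q)_oo / (z q^n;q)_oo, read as an identity of functions of z,
   i.e. with the common factors cancelled: the literal quotient is 0/0 at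
   z = q^-k for k >= n, and its two products diverge for |q| > 1.
   See qpoch_quotient for the agreement of the two. *)
Definition qpoch z q n : F :=
  match n with
  | Posz m => \prod_(k < m) (1 - z * q ^+ k)
  | Negz m => (\prod_(k < m.+1) (1 - z * q ^- k.+1))^-1
  end.

(* 1/(q;q)_n, extended by the convention 1/(q;q)_n = 0 for n < 0. *)
Definition inv_qpoch q n : F :=
  if n is Posz m then (qpoch q q m)^-1 else 0.

End QPochhammer.

Lemma qprod_split (F : numFieldType) (z q x y : F) (m : nat) :
  ((fun K => \prod_(k < K) (1 - z * q ^+ k)) @ \oo --> x)%classic ->
  ((fun K => \prod_(k < K) (1 - z * q ^+ m * q ^+ k)) @ \oo --> y)%classic ->
  x = \prod_(k < m) (1 - z * q ^+ k) * y.
Proof.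
move=> cx cy; rewrite -(cvg_shiftn m) in cx.
apply: (cvg_unique _ cx) => //=.
have ce : ((fun K => \prod_(k < m) (1 - z * q ^+ k) *
    \prod_(k < K) (1 - z * q ^+ m * q ^+ k)) @ \oo -->
    \prod_(k < m) (1 - z * q ^+ k) * y)%classic.
  by apply: cvgM cy; exact: cvg_cst.
apply: cvg_trans ce; apply: near_eq_cvg; apply: nearW => K /=.
rewrite addnC big_split_ord /=; congr (_ * _).
by apply: eq_bigr => i _; rewrite exprD mulrA.
Qed.

Lemma qpoch_quotient (F : numFieldType) (z q a b : F) (n : int) :
  q != 0 ->
  ((fun K => \prod_(k < K) (1 - z * q ^+ k)) @ \oo --> a)%classic ->
  ((fun K => \prod_(k < K) (1 - z * q ^ n * q ^+ k)) @ \oo --> b)%classic ->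
  b != 0 -> qpoch z q n = a / b.
Proof.
move=> q0; case: n => m ca cb b0.
  by rewrite (qprod_split ca cb) /= mulfK.
pose w := z * q ^ (Negz m).
have zE : z = w * q ^+ m.+1.
  by rewrite /w NegzE -exprnN mulfVK // expf_neq0.
have bE : b = \prod_(k < m.+1) (1 - w * q ^+ k) * a.
  by apply: (qprod_split cb); rewrite -zE.
have -> : qpoch z q (Negz m) = (\prod_(k < m.+1) (1 - w * q ^+ k))^-1.
  rewrite /= (reindex_inj rev_ord_inj) /=; congr (_^-1).
  apply: eq_bigr => i _; congr (1 - _).
  rewrite zE -mulrA; congr (_ * _).
  have -> : q ^+ m.+1 = q ^+ i * q ^+ (m.+1 - i.+1).+1.
    by rewrite -exprD subSS addnS subnKC // -ltnS.
  by rewrite mulfK // expf_neq0.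
move: b0; rewrite bE mulf_eq0 negb_or => /andP[p0 a0].
by rewrite invfM mulrCA mulfV // mulr1.
Qed.

Lemma malgUZ (K : choiceType) (A : nzRingType) (c : K) (a : A) :
  << a *g c >> = a *: << c >> :> {malg A[K]}.
Proof. by apply/malgP => k; rewrite mcoeffZ !mcoeffU mulr_natr. Qed.

Section Operators.
Variable R : realType.
Local Notation C := R[i].

Definition cexp (z : C) : C :=
  let: a +i* b := z in (expR a * cos b) +i* (expR a * sin b).

Lemma cexp0 : cexp 0 = 1.
Proof. by rewrite /cexp /= expR0 cos0 sin0 mulr1 mulr0. Qed.

Lemma cexpD (x y : C) : cexp (x + y) = cexp x * cexp y.
Proof.
case: x y => [a b] [c d]; rewrite /cexp /= expRD cosD sinD; apply/eqP.
by rewrite eq_complex /=; apply/andP; split; apply/eqP; ring.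
Qed.

(* V^{(x)4} is the free C-module on the labels (c_1,...,c_4) in Z^4, with
   << c >> standing for |c_1> (x) ... (x) |c_4> and v@_c for <c|v>. *)
Definition label := 'rV[int]_4.
Definition lab (c1 c2 c3 c4 : int) : label := \row_i [:: c1; c2; c3; c4]`_i.
Definition V4 := {malg C[label]}.
Definition operator := V4 -> V4.

Implicit Types (c d : label) (x y : V4).

Definition linext (f : label -> V4) : operator :=
  fun x => \sum_(c <- msupp x) x@_c *: f c.

Lemma linext_ket f c : linext f << c >> = f c.
Proof. by rewrite /linext msuppU oner_eq0 big_seq_fset1 mcoeffUU scale1r. Qed.

Lemma linextEw f x (D : {fset label}) : (msupp x `<=` D)%fset ->
  linext f x = \sum_(c <- D) x@_c *: f c.
Proof.
move=> sD; rewrite /linext (big_fset_incl _ sD) // => c _ /mcoeff_outdom ->.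
by rewrite scale0r.
Qed.

Lemma linext_is_linear f : linear (linext f).
Proof.
move=> k x y; pose D := (msupp x `|` msupp y `|` msupp (k *: x + y))%fset.
rewrite !(@linextEw _ _ D) /D; first last.
- exact: fsubsetUr.
- by apply: fsubset_trans (fsubsetUl _ _); apply: fsubsetUl.
- by apply: fsubset_trans (fsubsetUl _ _); apply: fsubsetUr.
rewrite scaler_sumr -big_split /=; apply: eq_bigr => c _.
by rewrite mcoeffD mcoeffZ scalerDl scalerA.
Qed.

HB.instance Definition _ f :=
  GRing.isLinear.Build C V4 V4 _ (linext f) (linext_is_linear f).

(* The integral linear combination sum_i a_i p_i + b_i u_i is the pair (a,b). *)
Definition linform := ('rV[int]_4 * 'rV[int]_4)%type.

Definition s1 : 'I_4 := @Ordinal 4 0 isT.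
Definition s2 : 'I_4 := @Ordinal 4 1 isT.
Definition s3 : 'I_4 := @Ordinal 4 2 isT.
Definition s4 : 'I_4 := @Ordinal 4 3 isT.

Definition p_ (i : 'I_4) : linform := (delta_mx 0 i, 0).
Definition u_ (i : 'I_4) : linform := (0, delta_mx 0 i).

Variable hbar : C.

(* [p_i, u_i] *)
Definition hcomm (i : 'I_4) : C :=
  if (i == s2) || (i == s4) then 2 * hbar else hbar.

Definition commutator (v w : linform) : C :=
  \sum_i hcomm i * (v.1 0 i * w.2 0 i - v.2 0 i * w.1 0 i)%:~R.

Definition exp_p (a : 'rV[int]_4) : operator :=
  linext (fun c => cexp (\sum_i (a 0 i)%:~R * (hcomm i * (c 0 i)%:~R)) *: << c >>).

Definition exp_u (b : 'rV[int]_4) : operator := linext (fun c => << c + b >>).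

(* e^{A+B} = e^{-[A,B]/2} e^A e^B with A = sum_i a_i p_i, B = sum_i b_i u_i. *)
Definition exp_op (v : linform) : operator := fun x =>
  cexp (- commutator (v.1, 0) (0, v.2) / 2) *: exp_p v.1 (exp_u v.2 x).

HB.instance Definition _ a := GRing.Linear.copy (exp_p a) (linext _).
HB.instance Definition _ b := GRing.Linear.copy (exp_u b) (linext _).

Lemma exp_op_is_linear v : linear (exp_op v).
Proof. by move=> k x y; rewrite /exp_op !linearP. Qed.

HB.instance Definition _ v :=
  GRing.isLinear.Build C V4 V4 _ (exp_op v) (exp_op_is_linear v).

Lemma exp_op_p i c : exp_op (p_ i) << c >> = cexp (hcomm i * (c 0 i)%:~R) *: << c >>.
Proof.
rewrite /exp_op /exp_u /exp_p linext_ket addr0 linext_ket /=.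
rewrite [commutator _ _]big1 ?oppr0 ?mul0r ?cexp0 ?scale1r; last first.
  by move=> j _; rewrite /= !mxE mulr0 mul0r subr0 mulr0.
congr (cexp _ *: _); rewrite (bigD1 i) //= big1 => [|j ji].
  by rewrite mxE !eqxx mul1r addr0.
by rewrite mxE (negPf ji) andbF mul0r.
Qed.

Lemma exp_op_u i c : exp_op (u_ i) << c >> = << c + delta_mx 0 i >>.
Proof.
rewrite /exp_op /exp_u /exp_p linext_ket linext_ket /=.
rewrite [commutator _ _]big1 ?oppr0 ?mul0r ?cexp0 ?scale1r; last first.
  by move=> j _; rewrite /= !mxE !mul0r subr0 mulr0.
rewrite [in cexp _]big1 ?cexp0 ?scale1r // => j _.
by rewrite mxE mul0r.
Qed.

Lemma exp_op_ket v c : exp_op v << c >> =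
  cexp (\sum_i hcomm i * (v.1 0 i)%:~R * ((c 0 i)%:~R + (v.2 0 i)%:~R / 2))
    *: << c + v.2 >>.
Proof.
rewrite /exp_op /exp_u /exp_p linext_ket linext_ket scalerA -cexpD.
set e := (e in cexp e); set e' := (e in _ = cexp e *: _).
suff -> : e = e' by [].
rewrite /e /e' /commutator mulNr mulr_suml -sumrN -big_split /=.
apply: eq_bigr => i _; rewrite !mxE mulr0 subr0 !rmorphM !rmorphD /=.
by field.
Qed.

Lemma eq_on_kets (f g : {linear V4 -> V4}) :
  (forall c, f << c >> = g << c >>) -> f =1 g.
Proof.
move=> fg x; rewrite [x]monalgE !linear_sum; apply: eq_bigr => c _ /=.
by rewrite malgUZ !linearZ /= fg.
Qed.

(* e^A e^B = e^{[A,B]/2} e^{A+B} *)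
Lemma exp_opM v w x :
  exp_op v (exp_op w x) = cexp (commutator v w / 2) *: exp_op (v + w) x.
Proof.
apply: (@eq_on_kets (exp_op v \o exp_op w)
  (cexp (commutator v w / 2) \*: exp_op (v + w))) => c /=.
rewrite !exp_op_ket linearZ /= exp_op_ket !scalerA -!cexpD.
rewrite -addrA [w.2 + v.2]addrC; congr (cexp _ *: _).
rewrite mulr_suml -!big_split /=; apply: eq_bigr => i _.
rewrite !mxE !rmorphB !rmorphD !rmorphM /=.
by field.
Qed.

(* Formal sums of operators; a product of such sums is expanded into the sum
   of all products of terms. *)
Record opsum := OpSum { op_index : choiceType; op_term : op_index -> operator }.

Definition opsum1 (f : operator) : opsum := @OpSum unit (fun=> f).

Definition opsumM (X Y : opsum) : opsum :=
  @OpSum (op_index X * op_index Y)%type (fun ij => op_term ij.1 \o op_term ij.2).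

Definition summable_element (X : opsum) c d : Prop :=
  finite_set [set i : op_index X | (op_term i << d >>)@_c != 0].

(* <c|X|d>, computed termwise; meaningful when summable_element X c d. *)
Definition matrix_element (X : opsum) c d : C :=
  \sum_(i \in [set: op_index X]) (op_term i << d >>)@_c.

Definition Psi (q : C) (U : operator) : opsum :=
  @OpSum nat (fun n x => ((- q) ^+ n / qpoch (q ^+ 2) (q ^+ 2) n) *: iter n U x).

Definition Psi_inv (q : C) (U : operator) : opsum :=
  @OpSum nat
    (fun n x => (q ^+ (n ^ 2) / qpoch (q ^+ 2) (q ^+ 2) n) *: iter n U x).

Definition rho24 : operator := linext (fun c => << col_perm (tperm s2 s4) c >>).

(* e^{p_1 (u_4 - u_2) / hbar}, with p_1 = hbar c_1 on << c >>. *)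
Definition exp_p1_u4_u2 : operator :=
  linext (fun c => exp_op ((u_ s4 - u_ s2) *~ c 0 s1) << c >>).

Definition K1234 : opsum :=
  let q := cexp hbar in
  let A := exp_op (p_ s2 + u_ s2 + p_ s4 - u_ s4 - p_ s3 *+ 2) in
  let B := exp_op (p_ s1 + u_ s1 + p_ s3 - u_ s3 - p_ s2) in
  opsumM (Psi (q ^+ 2) A)
    (opsumM (Psi q B)
       (opsumM (Psi_inv (q ^+ 2) A)
          (opsumM (opsum1 rho24) (opsum1 exp_p1_u4_u2)))).

End Operators.

(* Main.v *)
Require Import Defs.
From mathcomp Require Import all_boot all_order perm all_algebra.
From mathcomp.multinomials Require Import monalg.
From mathcomp Require Import complex all_classical all_reals.
From mathcomp Require Import ring zify.

Import GRing.Theory.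
Local Open Scope ring_scope.
Local Open Scope complex_scope.

(* On a ket, [A = e^(p2+u2+p4-u4-2p3)] and [B = e^(p1+u1+p3-u3-p2)] shift the
   labels and multiply by a power of [q].  The operator exp_p1_u4_u2 followed
   by rho24 sends [|d>] to [|d1, d4+d1, d3, d2-d1>], so the term [A^k B^m A^l]
   of the expansion contributes to [<c|K|d>] only if [m = c1 - d1] and
   [k + l = c2 - d1 - d4]: the matrix element is a finite sum over [l], which
   the finite q-binomial theorem in base [q^4], at [z = q^(-4m)], evaluates. *)

(** * The finite q-binomial theorem *)

Section QBinomial.
Variables (F : fieldType) (p : F).

Lemma qpochS (z : F) (n : nat) :
  qpoch z p n.+1 = qpoch z p n * (1 - z * p ^+ n).
Proof. exact: big_ord_recr. Qed.

Hypothesis p_generic : forall n : nat, (0 < n)%N -> p ^+ n <> 1.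

Lemma qpoch_neq0 (n : nat) : qpoch p p n != 0.
Proof.
apply/prodf_neq0 => k _; rewrite -exprS subr_eq0 eq_sym.
by apply/eqP/p_generic.
Qed.

(** This compares coefficients of t^n in the product of Euler's series for (zt;p)_oo and 1/(t;p)_oo.
    The induction rests on the recurrence (1 - p^(n+1)) S_(n+1) = (1 - z p^n) S_n, which both sides
    satisfy. *)
Lemma qbinomial (z : F) (n : nat) :
  \sum_(l < n.+1)
    (- z) ^+ l * p ^+ 'C(l, 2) / (qpoch p p (n - l)%N * qpoch p p l)
  = qpoch z p n / qpoch p p n.
Proof.
(* The sum is the convolution of [a] and [b], each of which obeys a first-order recurrence ([aS] and
   [bS]). *)
pose a l := (- z) ^+ l * p ^+ 'C(l, 2) / qpoch p p (Posz l).
pose b k := (qpoch p p (Posz k))^-1.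
under eq_bigr => l _ do rewrite invfM mulrCA -/(a l) -/(b _).
elim: n => [|n IHn].
  by rewrite big_ord1 /a /b subn0 /= !big_ord0 !expr0 invr1 !mulr1.
have qn0 k : 1 - p ^+ k.+1 != 0.
  by rewrite subr_eq0 eq_sym; apply/eqP/p_generic.
have bS k : (1 - p ^+ k.+1) * b k.+1 = b k.
  by rewrite /b qpochS -exprS invfM mulrCA mulfV ?mulr1.
have aS l : (1 - p ^+ l.+1) * a l.+1 = - z * p ^+ l * a l.
  rewrite /a qpochS -exprS binS bin1 exprD [(- z) ^+ _]exprS.
  by field; rewrite qpoch_neq0 qn0.
(* [1 - p^(k+l) = (1 - p^k) + p^k (1 - p^l)] splits the sum in two copies of
   the previous one. *)
apply: (mulfI (qn0 n)).
have -> : (1 - p ^+ n.+1) * (qpoch z p n.+1 / qpoch p p n.+1)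
          = (1 - z * p ^+ n) * (qpoch z p n / qpoch p p n).
  by rewrite !qpochS -exprS; field; rewrite qpoch_neq0 qn0.
rewrite -IHn mulr_sumr.
transitivity (\sum_(l < n.+2) (1 - p ^+ (n.+1 - l)) * b (n.+1 - l)%N * a l
  + \sum_(l < n.+2) p ^+ (n.+1 - l) * b (n.+1 - l)%N * ((1 - p ^+ l) * a l)).
  rewrite -big_split /=; apply: eq_bigr => l _.
  have -> : p ^+ n.+1 = p ^+ (n.+1 - l) * p ^+ l.
    by rewrite -exprD subnK // -ltnS.
  by ring.
(* The factor 1 - p^0 kills the last term of the first sum and the initial term of the second. What
   remains is S_n and, after a shift of l, - z p^n S_n. *)
rewrite big_ord_recr /= subnn expr0 subrr !mul0r addr0.
rewrite [X in _ + X = _]big_ord_recl /= expr0 subrr mul0r mulr0 add0r.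
rewrite mulrBl mul1r mulr_sumr -sumrN; congr (_ + _).
  by apply: eq_bigr => l _; rewrite subSn -1?ltnS // bS mulrC.
apply: eq_bigr => l _; rewrite /bump /= add1n subSS aS.
have -> : p ^+ n = p ^+ (n - l) * p ^+ l by rewrite -exprD subnK // -ltnS.
by ring.
Qed.

End QBinomial.

(** * Action of the exponentials on basis kets *)

Section Action.
Variables (R : realType) (hbar : R[i]).
Local Notation q := (cexp hbar).

Lemma cexpN_mul (x : R[i]) : cexp (- x) * cexp x = 1.
Proof. by rewrite -cexpD addNr cexp0. Qed.

Lemma cexp_neq0 (x : R[i]) : cexp x != 0.
Proof.
by apply: contra_neq (oner_neq0 R[i]) => x0; rewrite -(cexpN_mul x) x0 mulr0.
Qed.

Lemma cexpN (x : R[i]) : cexp (- x) = (cexp x)^-1.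
Proof.
by apply: (mulIf (cexp_neq0 x)); rewrite cexpN_mul mulVf ?cexp_neq0.
Qed.

Lemma cexp_mulz (x : R[i]) (n : int) : cexp (x * n%:~R) = cexp x ^ n.
Proof.
have nat_case m : cexp (x * m%:R) = cexp x ^+ m.
  elim: m => [|m IHm]; first by rewrite mulr0 cexp0.
  by rewrite -natr1 mulrDr mulr1 cexpD IHm exprSr.
case: n => m; first exact: nat_case.
by rewrite NegzE rmorphN mulrN cexpN [cexp _]nat_case exprnN.
Qed.

Lemma lab_eq (a1 a2 a3 a4 b1 b2 b3 b4 : int) :
  (lab a1 a2 a3 a4 == lab b1 b2 b3 b4) =
  [&& a1 == b1, a2 == b2, a3 == b3 & a4 == b4].
Proof.
apply/eqP/and4P => [/rowP E|[/eqP-> /eqP-> /eqP-> /eqP->] //].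
by split; apply/eqP; [have := E s1|have := E s2|have := E s3|have := E s4];
  rewrite !mxE.
Qed.

Lemma labD (a1 a2 a3 a4 b1 b2 b3 b4 : int) :
  lab a1 a2 a3 a4 + lab b1 b2 b3 b4 =
  lab (a1 + b1) (a2 + b2) (a3 + b3) (a4 + b4).
Proof. by apply/rowP => -[[|[|[|[|//]]]] i4]; rewrite !mxE. Qed.

(* Used where [congr] diverges, comparing the algebraic instances of [R[i]] and
   [V4 R] up to conversion. *)
Lemma eq_scale_lab (x y : R[i]) (a1 a2 a3 a4 b1 b2 b3 b4 : int) :
  x = y -> a1 = b1 -> a2 = b2 -> a3 = b3 -> a4 = b4 ->
  x *: << lab a1 a2 a3 a4 >> = y *: << lab b1 b2 b3 b4 >> :> V4 R.
Proof. by move=> -> -> -> -> ->. Qed.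

(** The p-part acts after the shift by b and yields a.(c + b); the correction from splitting the
    exponential removes half of a.b. The weights 2 come from [hcomm]. *)
Lemma exp_op_lab (a1 a2 a3 a4 b1 b2 b3 b4 c1 c2 c3 c4 : int) :
  exp_op hbar (lab a1 a2 a3 a4, lab b1 b2 b3 b4) << lab c1 c2 c3 c4 >> =
  cexp (hbar * (a1 * c1 + 2 * a2 * c2 + a3 * c3 + 2 * a4 * c4)%:~R
        + hbar / 2 * (a1 * b1 + 2 * a2 * b2 + a3 * b3 + 2 * a4 * b4)%:~R)
    *: << lab (c1 + b1) (c2 + b2) (c3 + b3) (c4 + b4) >>.
Proof.
rewrite exp_op_ket labD; apply: eq_scale_lab => //; congr (cexp _).
rewrite !big_ord_recl big_ord0 /= /hcomm !mxE /=.
rewrite !rmorphD !rmorphM /=.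
by field.
Qed.

Lemma cexp_exprzD (x : R[i]) (m n : int) :
  cexp x ^ m * cexp x ^ n = cexp x ^ (m + n).
Proof. by rewrite expfzDr ?cexp_neq0. Qed.

Lemma exp_opZ v (a : R[i]) (x : V4 R) :
  exp_op hbar v (a *: x) = a *: exp_op hbar v x.
Proof. exact: linearZ. Qed.

Local Notation opA :=
  (exp_op hbar (p_ s2 + u_ s2 + p_ s4 - u_ s4 - p_ s3 *+ 2)).
Local Notation opB :=
  (exp_op hbar (p_ s1 + u_ s1 + p_ s3 - u_ s3 - p_ s2)).

(** No half power of q survives: the contributions of slots 2 and 4 to a.b cancel. For [opB_lab],
    those of slots 1 and 3 do. *)
Lemma opA_lab (c1 c2 c3 c4 : int) :
  opA << lab c1 c2 c3 c4 >> =
  q ^ (2 * (c2 + c4 - c3)) *: << lab c1 (c2 + 1) c3 (c4 - 1) >>.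
Proof.
have -> : p_ s2 + u_ s2 + p_ s4 - u_ s4 - p_ s3 *+ 2
          = (lab 0 1 (- 2) 1, lab 0 1 0 (- 1)).
  by congr (_, _); apply/rowP => -[[|[|[|[|//]]]] i4]; rewrite !mxE.
rewrite exp_op_lab -cexp_mulz.
apply: eq_scale_lab; rewrite ?addr0 //; congr (cexp _).
by rewrite !(rmorphD, rmorphM, rmorphN) /=; field.
Qed.

Lemma opB_lab (c1 c2 c3 c4 : int) :
  opB << lab c1 c2 c3 c4 >> =
  q ^ (c1 + c3 - 2 * c2) *: << lab (c1 + 1) c2 (c3 - 1) c4 >>.
Proof.
have -> : p_ s1 + u_ s1 + p_ s3 - u_ s3 - p_ s2
          = (lab 1 (- 1) 1 0, lab 1 0 (- 1) 0).
  by congr (_, _); apply/rowP => -[[|[|[|[|//]]]] i4]; rewrite !mxE.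
rewrite exp_op_lab -cexp_mulz.
apply: eq_scale_lab; rewrite ?addr0 //; congr (cexp _).
by rewrite !(rmorphD, rmorphM, rmorphN) /=; field.
Qed.

(** The exponent is linear in n because A preserves c2 + c4 - c3; likewise B preserves c1 + c3 - 2
    c2. *)
Lemma iter_opA_lab (n : nat) (c1 c2 c3 c4 : int) :
  iter n opA << lab c1 c2 c3 c4 >> =
  q ^ (2 * (c2 + c4 - c3) * n) *: << lab c1 (c2 + n) c3 (c4 - n%:Z) >>.
Proof.
elim: n => [|n IHn]; first by rewrite mulr0 expr0z scale1r addr0 subr0.
rewrite iterS IHn exp_opZ opA_lab scalerA cexp_exprzD.
by apply: eq_scale_lab => //; [congr (_ ^ _)|..]; nia.
Qed.

Lemma iter_opB_lab (n : nat) (c1 c2 c3 c4 : int) :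
  iter n opB << lab c1 c2 c3 c4 >> =
  q ^ ((c1 + c3 - 2 * c2) * n) *: << lab (c1 + n) c2 (c3 - n%:Z) c4 >>.
Proof.
elim: n => [|n IHn]; first by rewrite mulr0 expr0z scale1r addr0 subr0.
rewrite iterS IHn exp_opZ opB_lab scalerA cexp_exprzD.
by apply: eq_scale_lab => //; [congr (_ ^ _)|..]; nia.
Qed.

Lemma exp_p1_u4_u2_lab (d1 d2 d3 d4 : int) :
  exp_p1_u4_u2 hbar << lab d1 d2 d3 d4 >> = << lab d1 (d2 - d1) d3 (d4 + d1) >>.
Proof.
rewrite /exp_p1_u4_u2 linext_ket.
have -> : u_ s4 - u_ s2 = (lab 0 0 0 0, lab 0 (- 1) 0 1).
  by congr (_, _); apply/rowP => -[[|[|[|[|//]]]] i4]; rewrite !mxE.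
have -> : (lab 0 0 0 0, lab 0 (- 1) 0 1) *~ lab d1 d2 d3 d4 0 s1
          = (lab 0 0 0 0, lab 0 (- d1) 0 d1) :> linform.
  rewrite [lab _ _ _ _ _ _]mxE /= [LHS]surjective_pairing.
  rewrite (raddfMz (@fst _ _)) (raddfMz (@snd _ _)) -!scaler_int intz /=.
  congr (_, _); apply/rowP => -[[|[|[|[|//]]]] i4];
  by rewrite !mxE /= ?mulr0 ?mulrN ?mulr1.
rewrite exp_op_lab; set x := (x in cexp x *: _).
have -> : x = 0 by rewrite /x !(mul0r, mulr0, add0r).
by rewrite cexp0 scale1r [d1 + 0]addr0 [d3 + 0]addr0.
Qed.

Lemma rho24_lab (d1 d2 d3 d4 : int) :
  @rho24 R << lab d1 d2 d3 d4 >> = << lab d1 d4 d3 d2 >>.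
Proof.
rewrite /rho24 linext_ket; congr << _ >>.
by apply/rowP => -[[|[|[|[|//]]]] i4]; rewrite !mxE permE /=.
Qed.

End Action.

(** Brings a term of the expansion to the shape of a q-binomial summand, with x = q and P, W, Q the
    inverse Pochhammer symbols of k, m, l. The hypothesis compares exponents of x, using 4 C(l,2) =
    2l(l - 1). *)
Lemma regroup_powers (F : fieldType) (x P Q W : F) (k l m : nat) (E e : int) :
  x != 0 ->
  E + 2 * k%:Z + m%:Z + 2 * l%:Z * l%:Z
    = e - 4 * m%:Z * l%:Z + 2 * l%:Z * (l%:Z - 1) ->
  (- x ^+ 2) ^+ k * P * ((- x) ^+ m * W * ((x ^+ 2) ^+ (l ^ 2) * Q * x ^ E)) =
  x ^ e * (-1) ^+ (m + (k + l)) * W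
  * ((- x ^ (- 4 * m%:Z)) ^+ l * (x ^+ 4) ^+ 'C(l, 2) * (P * Q)).
Proof.
move=> x0 expE.
rewrite [(- x ^+ 2) ^+ k]exprNn [(- x) ^+ m]exprNn [(- x ^ _) ^+ l]exprNn.
have powE : (x ^+ 2) ^+ k * x ^+ m * (x ^+ 2) ^+ (l ^ 2) * x ^ E =
    x ^ e * (x ^ (- 4 * m%:Z)) ^+ l * (x ^+ 4) ^+ 'C(l, 2).
  rewrite -!exprM !exprnP !exprz_exp -!expfzDr //; congr (x ^ _).
  (* [mul_bin_diag] involves the truncated predecessor of l, hence the case split at l = 0. *)
  have binE : 2 * ('C(l, 2))%:Z = l%:Z * (l%:Z - 1).
    by have := mul_bin_diag l 1; rewrite bin1; case: (l) => [|l'] /=; nia.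
  by rewrite !PoszM; move: expE; lia.
have signE : (-1) ^+ (m + (k + l)) * (-1) ^+ l = (-1) ^+ k * (-1) ^+ m :> F.
  by rewrite addnA exprD -mulrA -expr2 sqrr_sign mulr1 addnC exprD.
transitivity ((-1) ^+ k * (-1) ^+ m
  * ((x ^+ 2) ^+ k * x ^+ m * (x ^+ 2) ^+ (l ^ 2) * x ^ E) * (P * Q * W)).
  by ring.
by rewrite -signE powE; ring.
Qed.

(** * Single terms of the expansion *)

Section Kernel.
Variables (R : realType) (hbar : R[i]).
Local Notation q := (cexp hbar).

Lemma iter_exp_opZ v (n : nat) (a : R[i]) (x : V4 R) :
  iter n (exp_op hbar v) (a *: x) = a *: iter n (exp_op hbar v) x.
Proof. by elim: n => [|n IHn]; [|rewrite !iterS IHn; exact: exp_opZ]. Qed.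

(** The three summands of the last exponent come from A^l, B^m and A^k in this order, each evaluated
    at the labels left by the preceding operators. *)
Definition K1234_coef (k m l : nat) (d1 d2 d3 d4 : int) : R[i] :=
  (- q ^+ 2) ^+ k / qpoch ((q ^+ 2) ^+ 2) ((q ^+ 2) ^+ 2) k
  * ((- q) ^+ m / qpoch (q ^+ 2) (q ^+ 2) m
     * ((q ^+ 2) ^+ (l ^ 2) / qpoch ((q ^+ 2) ^+ 2) ((q ^+ 2) ^+ 2) l
        * q ^ (2 * (d2 + d4 - d3) * l + (d3 - d1 - 2 * (d4 + l%:Z)) * m
               + 2 * (d2 + d4 - d3 + m%:Z) * k))).

Lemma K1234_term_lab (k m l : nat) (i j : unit) (d1 d2 d3 d4 : int) :
  op_term (o := K1234 hbar) (k, (m, (l, (i, j)))) << lab d1 d2 d3 d4 >> =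
  K1234_coef k m l d1 d2 d3 d4 *:
    << lab (d1 + m) (d4 + d1 + l + k) (d3 - m%:Z) (d2 - d1 - l%:Z - k%:Z) >>.
Proof.
rewrite /K1234_coef.
set a := _ / _; set b := _ / _; set c := _ / _.
set A := exp_op hbar (p_ s2 + u_ s2 + p_ s4 - u_ s4 - p_ s3 *+ 2).
set B := exp_op hbar (p_ s1 + u_ s1 + p_ s3 - u_ s3 - p_ s2).
transitivity (a *: iter k A (b *: iter m B (c *: iter l A
    (rho24 (exp_p1_u4_u2 hbar << lab d1 d2 d3 d4 >>))))); first by [].
rewrite exp_p1_u4_u2_lab rho24_lab (iter_opA_lab R hbar l) scalerA.
rewrite (iter_exp_opZ _ m) (iter_opB_lab R hbar m) !scalerA.
rewrite (iter_exp_opZ _ k) (iter_opA_lab R hbar k) !scalerA.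
apply: eq_scale_lab => //.
set x := (x in _ = a * (b * (c * (q ^ x)))).
set x1 := 2 * _ * l%:Z; set x2 := (_ - 2 * _) * m%:Z; set x3 := 2 * _ * k%:Z.
have -> : x = x1 + x2 + x3 by rewrite /x /x1 /x2 /x3; ring.
by rewrite -!cexp_exprzD; ring.
Qed.

Lemma K1234_entry (k m l : nat) (i j : unit) (c1 c2 c3 c4 d1 d2 d3 d4 : int) :
  (op_term (o := K1234 hbar) (k, (m, (l, (i, j)))) << lab d1 d2 d3 d4 >>)@_
    (lab c1 c2 c3 c4) =
  if [&& m%:Z == c1 - d1, (k + l)%N%:Z == c2 - d1 - d4,
      c1 + c3 == d1 + d3 & c2 + c4 == d2 + d4]
  then K1234_coef k m l d1 d2 d3 d4 else 0.
Proof.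
rewrite K1234_term_lab mcoeffZ mcoeffU lab_eq mulr_natr mulrb.
set t := [&& _, _, _ & _]; set t' := [&& _, _, _ & _].
(* Adding label equations pairwise (1 with 3, 2 with 4) gives the two conservation laws. *)
by have -> : t = t' by rewrite /t /t'; lia.
Qed.

(** For fixed m and k + l, only the last parenthesis varies with l. *)
Lemma K1234_coefE (k m l : nat) (d1 d2 d3 d4 : int) :
  K1234_coef k m l d1 d2 d3 d4 =
  q ^ (m%:Z * (- d1 + d3 - 2 * d4 + 1)
       + 2 * (k + l)%N%:Z * (d2 + d4 - (d3 - m%:Z) + 1))
  * (-1) ^+ (m + (k + l)) / qpoch (q ^+ 2) (q ^+ 2) m
  * ((- q ^ (- 4 * m%:Z)) ^+ l * (q ^+ 4) ^+ 'C(l, 2)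
     / (qpoch (q ^+ 4) (q ^+ 4) k * qpoch (q ^+ 4) (q ^+ 4) l)).
Proof.
rewrite /K1234_coef -exprM !invfM; set E := (E in q ^ E).
set e := (e in q ^ e * _).
apply: regroup_powers; first exact: cexp_neq0.
by rewrite /E /e; ring.
Qed.

End Kernel.

(** A list containing the support settles summability and value at once; the empty list serves when
    every term vanishes. *)
Lemma matrix_element_seq (R : realType) (X : opsum R) (c d : label)
    (r : seq (op_index X)) :
  uniq r -> (forall i, i \notin r -> (op_term i << d >>)@_c = 0) ->
  summable_element X c d /\
  matrix_element X c d = \sum_(i <- r) (op_term i << d >>)@_c.
Proof.
move=> r_uniq r_supp; split.
  apply: sub_finite_set (finite_seq r) => i /= Fi0.
  by apply: contraNT Fi0 => /r_supp/eqP.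
rewrite /matrix_element (fsbigE _ _ r_uniq) // => [|i _ /r_supp //].
by apply: eq_bigl => i; rewrite in_setT.
Qed.

(** * Summation of the expansion *)

Theorem proposition6p7 (R : realType) (hbar : R[i]) (q : R[i])
    (q_def : q = cexp hbar)
    (hbar_generic : forall n : nat, (0 < n)%N -> q ^+ n <> 1)
    (c1 c2 c3 c4 d1 d2 d3 d4 : int) :
  let c := lab c1 c2 c3 c4 in
  let d := lab d1 d2 d3 d4 in
  let e := (c1 - d1) * (- d1 + d3 - 2 * d4 + 1)
           + 2 * (c2 - d1 - d4) * (d2 + d4 - c3 + 1) in
  summable_element (K1234 hbar) c d /\
  matrix_element (K1234 hbar) c d =
    q ^ e * (-1) ^ (c1 + c2 - d4)
    * (qpoch (q ^ (- 4 * (c1 - d1))) (q ^+ 4) (c2 - d1 - d4)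
       * inv_qpoch (q ^+ 4) (c2 - d1 - d4) * inv_qpoch (q ^+ 2) (c1 - d1))
    * (c1 + c3 == d1 + d3)%:R * (c2 + c4 == d2 + d4)%:R.
Proof.
have q4_generic n : (0 < n)%N -> (q ^+ 4) ^+ n <> 1.
  by move=> n0; rewrite -exprM; apply: hbar_generic; lia.
rewrite q_def in q4_generic *.
move=> c d e.
pose ind (k m l : nat) : op_index (K1234 hbar) := (k, (m, (l, (tt, tt)))).
have [[m [n [mE nE ceq13 ceq24]]]|infeasible] := pselect (exists m n : nat,
    [/\ c1 - d1 = m%:Z, c2 - d1 - d4 = n%:Z, c1 + c3 = d1 + d3
      & c2 + c4 = d2 + d4]).
(* With m and n = k + l fixed, l in 0..n is the only free index. *)
- have [||summ ->] := @matrix_element_seq R (K1234 hbar) c d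
    [seq ind (n - l)%N m l | l <- iota 0 n.+1].
  + by rewrite map_inj_uniq ?iota_uniq // => l l' [].
  + case=> k [m' [l [[] []]]] ir; rewrite K1234_entry; case: ifP => // /and4P[].
    rewrite mE nE !eqz_nat => /eqP m'm /eqP kl _ _; case/negP: ir.
    apply/mapP; exists l; first by rewrite mem_iota; move: kl; clear; lia.
    by rewrite /ind -kl addnK m'm.
  split=> //; rewrite big_map.
  have eE : e = m%:Z * (- d1 + d3 - 2 * d4 + 1)
                + 2 * n%:Z * (d2 + d4 - (d3 - m%:Z) + 1).
    by rewrite /e mE nE (_ : c3 = d3 - m%:Z) //; lia.
  have signE : (-1 : R[i]) ^ (c1 + c2 - d4) = (-1) ^+ (m + n).
    rewrite (_ : c1 + c2 - d4 = (m + n)%N%:Z + 2 * d1); last by lia.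
    have sq : (-1 : R[i]) ^ (2 : int) = 1.
      by rewrite -[2]/(2%:Z) -exprnP sqrrN expr1n.
    by rewrite expfzDr ?oppr_eq0 ?oner_eq0 // -exprz_exp sq exp1rz mulr1.
  rewrite signE eE mE nE ceq13 ceq24 !eqxx !mulr1 /inv_qpoch.
  (* The closed form is expanded back into a sum over l, so that both sides match term by term. *)
  rewrite -(qbinomial _ _ q4_generic) mulr_suml mulr_sumr.
  rewrite -/(index_iota 0 n.+1) big_mkord; apply: eq_bigr => l _.
  rewrite K1234_entry subnK -1?ltnS // mE nE ceq13 ceq24 !eqxx /=.
  by rewrite K1234_coefE subnK -1?ltnS //; ring.
- have [||summ ->] := @matrix_element_seq R (K1234 hbar) c d [::] => //.
    case=> k [m [l [i j]]] _; rewrite K1234_entry; case: ifP => // /and4P[].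
    move=> /eqP mE /eqP nE /eqP ceq13 /eqP ceq24; case: infeasible.
    by exists m, (k + l)%N.
  split=> //; rewrite big_nil; apply/esym.
  (* The right-hand side vanishes too: a negative index makes [inv_qpoch] zero, and a violated
     conservation law makes a Kronecker delta zero. *)
  case mE: (c1 - d1) => [m|m]; last by rewrite !(mulr0, mul0r).
  case nE: (c2 - d1 - d4) => [n|n]; last by rewrite !(mulr0, mul0r).
  case: eqP => [ceq13|_]; last by rewrite mulr0 mul0r.
  case: eqP => [ceq24|_]; last by rewrite mulr0.
  by case: infeasible; exists m, n.
Qed.
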